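(* Let $L \ge 1$ be an integer, $a \in \mathbb{R}^L$, $\ell^c \in [0,1]^L$, and $b \in \mathbb{R}$, and suppose that the feasible set $\{\theta \in \mathbb{R}^L : a^T\theta \ge b,\ 0 \le \theta_i \le 1-\ell^c_i \text{ for all } i\}$ is nonempty. Define $f : \mathbb{R}_{\ge 0} \to \mathbb{R}$ and $\delta f : \mathbb{R}_{\ge 0} \to \mathbb{R}$ by $$f(\lambda) = a^T \operatorname{clip}_{0,1-\ell^c}(\lambda a) - b, \qquad \delta f(\lambda) = \sum_{i\,:\, 0 < a_i \text{ and } \lambda a_i < 1-\ell^c_i} a_i^2 .$$ If $b > 0$, then the quasi-Newton iteration $$\lambda_0 = 0, \qquad \lambda_{k+1} = \lambda_k - \frac{f(\lambda_k)}{\delta f(\lambda_k)},$$ stopped as soon as $f(\lambda_k)=0$, is well defined (i.e. $\delta f(\lambda_k) \neq 0$ whenever $f(\lambda_k) \ne 0$) and reaches, after at most $L+1$ iterations, a root $\lambda_\ast$ of $f$ (that is, $\lambda_k = \lambda_\ast$ with $f(\lambda_\ast)=0$ for some $k \le L+1$) such that $\operatorname{clip}_{0,1-\ell^c}(\lambda_\ast a)$ solves the quadratic knapsack problem $$\min \left\{ \theta^T\theta \;:\; \theta \in \mathbb{R}^L,\ a^T\theta \ge b,\ 0 \le \theta_i \le 1-\ell^c_i \text{ for all } i \right\}.$$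
   Context: For vectors $x, y, z \in \mathbb{R}^L$ with $y_i \le z_i$ for all $i$, $\operatorname{clip}_{y,z}(x) \in \mathbb{R}^L$ is the vector obtained by clipping the components of $x$ elementwise between those of $y$ and $z$: $\operatorname{clip}_{y,z}(x)_i = \min(\max(x_i, y_i), z_i)$. In $\operatorname{clip}_{0,1-\ell^c}$, $0$ denotes the zero vector and $1-\ell^c$ the vector with components $1-\ell^c_i$. The function $\delta f$ is the right-derivative of $f$. *)

(* Defs.v *)
From HB Require Import structures.
From mathcomp Require Import all_boot all_order all_algebra.
From mathcomp Require Import reals.

Set Implicit Arguments.
Unset Strict Implicit.
Unset Printing Implicit Defensive.

Import Order.TTheory GRing.Theory Num.Theory.
Local Open Scope ring_scope.

Section QuadraticKnapsack.
Context {R : realType} {L : nat}.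
Implicit Types (x y z a lc th : 'cV[R]_L) (b lam : R).

Definition dotv x y : R := (x^T *m y) 0 0.

Definition clip y z x : 'cV[R]_L :=
  \col_i Num.min (Num.max (x i 0) (y i 0)) (z i 0).

Definition upper lc : 'cV[R]_L := const_mx 1 - lc.

Definition feasible a lc b th : Prop :=
  b <= dotv a th /\ forall i, 0 <= th i 0 <= 1 - lc i 0.

Definition solves_knapsack a lc b th : Prop :=
  feasible a lc b th /\
  forall th', feasible a lc b th' -> dotv th th <= dotv th' th'.

(* The mathematical domain of [knap_f] and [knap_df] is [0, +oo[; they are
   total here, so a statement about iterates must say that they stay in it. *)
Definition knap_f a lc b lam : R := dotv a (clip 0 (upper lc) (lam *: a)) - b.

Definition knap_df a lc lam : R :=
  \sum_(i < L | (0 < a i 0) && (lam * a i 0 < 1 - lc i 0)) a i 0 ^+ 2.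

(* The sequence is constant from the first root of [knap_f] on: this encodes
   the stopping rule.  Since [x / 0 = 0], nonvanishing of [knap_df] before
   that point is not built in. *)
Fixpoint newton_iter a lc b (k : nat) : R :=
  if k is k'.+1 then
    let lam := newton_iter a lc b k' in
    if knap_f a lc b lam == 0 then lam
    else lam - knap_f a lc b lam / knap_df a lc lam
  else 0.

End QuadraticKnapsack.

(* Main.v *)
(** On [0, +oo[ the function f is concave and piecewise linear, and
    [knap_df] is a supergradient of it.  Hence Newton iterates started where
    [f < 0] stay where [f <= 0] and increase.  The slope is determined by the
    set of indices that are not yet saturated; this set shrinks, and if it is
    the same at two consecutive iterates then f is linear between them, so the
    second one is a root.  As the set has at most L elements, a root is reached
    after at most L steps.  Feasibility makes the set nonempty where [f < 0].
    A root is the Lagrange multiplier of the constraint [b <= dotv a th], and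
    clipping minimizes the (separable) Lagrangian over the box. *)
Require Import Defs.
From HB Require Import structures.
From mathcomp Require Import all_boot all_order all_algebra.
From mathcomp Require Import reals.
From mathcomp Require Import ring lra.

Set Implicit Arguments.
Unset Strict Implicit.
Unset Printing Implicit Defensive.

Import Order.TTheory GRing.Theory Num.Theory.
Local Open Scope ring_scope.

Section ScalarClip.
Context {R : realDomainType}.
Implicit Types (a u l m t x : R).

Lemma clip_ge0_le x u : 0 <= u -> 0 <= Num.min (Num.max x 0) u <= u.
Proof.
by move=> u0; rewrite le_min le_max lexx orbT u0 ge_min lexx orbT.
Qed.

Lemma mul_clip_unsaturated a u l : 0 <= l -> 0 <= a -> l * a <= u ->
  a * Num.min (Num.max (l * a) 0) u = l * a ^+ 2.
Proof.
move=> l0 a0 lau; rewrite (max_l (mulr_ge0 l0 a0)) min_l //; ring.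
Qed.

Lemma mul_clip_saturated a u l : 0 <= u -> 0 <= a -> u <= l * a ->
  a * Num.min (Num.max (l * a) 0) u = a * u.
Proof. by move=> u0 a0 ula; rewrite max_l ?(le_trans u0) // min_r. Qed.

Lemma mul_clip_nonpos a u l : 0 <= u -> 0 <= l -> a <= 0 ->
  a * Num.min (Num.max (l * a) 0) u = 0.
Proof.
by move=> u0 l0 a0; rewrite max_r ?mulr_ge0_le0 // min_l // mulr0.
Qed.

(** For [0 < a] the term is the minimum of [m * a ^+ 2] and [a * u], concave in [m], and the
    coefficient of [m - l] is its right-derivative at [l]. For [a <= 0] the term vanishes. *)
Lemma mul_clip_supergradient a u l m : 0 <= u -> 0 <= l -> 0 <= m ->
  a * Num.min (Num.max (m * a) 0) u <=
  a * Num.min (Num.max (l * a) 0) u +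
    (if (0 < a) && (l * a < u) then a ^+ 2 else 0) * (m - l).
Proof.
move=> u0 l0 m0; case: (ltP 0 a) => [a0|a0] /=; last first.
  by rewrite !mul_clip_nonpos // mul0r addr0.
have [lau|ula] := ltP (l * a) u.
  rewrite (mul_clip_unsaturated l0 (ltW a0) (ltW lau)) mulrBr.
  rewrite [_ * l]mulrC addrC subrK expr2 -mulrA ler_pM2l //.
  by rewrite ge_min (max_l (mulr_ge0 m0 (ltW a0))) mulrC lexx.
rewrite (mul_clip_saturated u0 (ltW a0) ula) mul0r addr0 ler_pM2l //.
by rewrite ge_min lexx orbT.
Qed.

(** With equal slopes at [l] and [m], the supergradient inequalities based at either point are
    opposite to each other. *)
Lemma mul_clip_linear a u l m : 0 <= u -> 0 <= l -> 0 <= m ->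
  (0 < a) && (l * a < u) = (0 < a) && (m * a < u) ->
  a * Num.min (Num.max (m * a) 0) u =
  a * Num.min (Num.max (l * a) 0) u +
    (if (0 < a) && (l * a < u) then a ^+ 2 else 0) * (m - l).
Proof.
move=> u0 l0 m0 same; apply/le_anti.
rewrite mul_clip_supergradient //= -lerBrDr -mulrN opprB.
by rewrite same mul_clip_supergradient.
Qed.

(** Up to the constant [x ^+ 2], the objective is the squared distance to [x], and [c] is the
    projection of [x] onto the interval. *)
Lemma clip_lagrangian_min x u t : 0 <= t <= u ->
  let c := Num.min (Num.max x 0) u in
  c ^+ 2 - 2 * x * c <= t ^+ 2 - 2 * x * t.
Proof.
move=> /andP[t0 tu] /=.
have [x0|x0] := leP x 0.
  rewrite min_l ?(le_trans t0) // expr0n mulr0 subrr subr_ge0.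
  apply: le_trans (sqr_ge0 t); rewrite mulr_le0_ge0 //; lra.
have [xu|ux] := leP x u; first by have := sqr_ge0 (t - x); nra.
(* Here [c = u], and this product is exactly the difference of the two sides. *)
have : 0 <= (u - t) * (x - u + (x - t)) by rewrite mulr_ge0 //; lra.
nra.
Qed.

Lemma mul_le_clip_saturated a u l t : 0 <= l -> 0 <= t <= u ->
  ~~ ((0 < a) && (l * a < u)) ->
  a * t <= a * Num.min (Num.max (l * a) 0) u.
Proof.
move=> l0 /andP[t0 tu]; have u0 := le_trans t0 tu.
case: (ltP 0 a) => [a0|a0 _] /=; last first.
  by rewrite mul_clip_nonpos // mulr_le0_ge0.
rewrite -leNgt => ula.
by rewrite (mul_clip_saturated u0 (ltW a0) ula) ler_pM2l.
Qed.

End ScalarClip.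

Section Newton.
Context {R : realType} {L : nat}.
Variables (a lc : 'cV[R]_L) (b : R).
Hypothesis hlc : forall i, 0 <= lc i 0 <= 1.

Local Notation f := (knap_f a lc b).
Local Notation df := (knap_df a lc).
Local Notation lam := (newton_iter a lc b).

Definition unsaturated (l : R) : {set 'I_L} :=
  [set i | (0 < a i 0) && (l * a i 0 < 1 - lc i 0)].

Lemma dotvE (x y : 'cV[R]_L) : dotv x y = \sum_i x i 0 * y i 0.
Proof. by rewrite /dotv mxE; apply: eq_bigr => i _; rewrite mxE. Qed.

Lemma upper_ge0 i : 0 <= 1 - lc i 0.
Proof. by rewrite subr_ge0; case/andP: (hlc i). Qed.

Lemma clip_coord (l : R) i : (clip 0 (upper lc) (l *: a)) i 0 =
  Num.min (Num.max (l * a i 0) 0) (1 - lc i 0).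
Proof. by rewrite !mxE. Qed.

Lemma knap_fE l : f l =
  \sum_i a i 0 * Num.min (Num.max (l * a i 0) 0) (1 - lc i 0) - b.
Proof.
by rewrite /knap_f dotvE; under eq_bigr do rewrite clip_coord.
Qed.

Lemma knap_fD_df l m : f l + df l * (m - l) =
  \sum_i (a i 0 * Num.min (Num.max (l * a i 0) 0) (1 - lc i 0) +
    (if (0 < a i 0) && (l * a i 0 < 1 - lc i 0) then a i 0 ^+ 2 else 0) *
      (m - l)) - b.
Proof. by rewrite big_split -mulr_suml -big_mkcond knap_fE /= addrAC. Qed.

Lemma knap_f_supergradient l m : 0 <= l -> 0 <= m ->
  f m <= f l + df l * (m - l).
Proof.
move=> l0 m0; rewrite knap_fD_df knap_fE lerD2r ler_sum // => i _.
by rewrite mul_clip_supergradient ?upper_ge0.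
Qed.

Lemma knap_f_linear l m : 0 <= l -> 0 <= m ->
  unsaturated l = unsaturated m -> f m = f l + df l * (m - l).
Proof.
move=> l0 m0 /setP same; rewrite knap_fD_df knap_fE; congr (_ - _).
apply: eq_bigr => i _; apply: mul_clip_linear; rewrite ?upper_ge0 //.
by have := same i; rewrite !inE.
Qed.

Lemma unsaturatedS l m : l <= m -> unsaturated m \subset unsaturated l.
Proof.
move=> lm; apply/subsetP => i; rewrite !inE => /andP[a0 ma] /=.
by rewrite a0 (le_lt_trans _ ma) // ler_pM2r.
Qed.

Lemma knap_df_gt0 l : unsaturated l != set0 -> 0 < df l.
Proof.
case/set0Pn => i; rewrite inE => Pi.
rewrite /knap_df (bigD1 i) //= ltr_pwDl //.
  by rewrite exprn_gt0 //; case/andP: Pi.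
by rewrite sumr_ge0 // => j _; rewrite sqr_ge0.
Qed.

Lemma knap_root_solves l : 0 <= l -> f l = 0 ->
  solves_knapsack a lc b (clip 0 (upper lc) (l *: a)).
Proof.
move=> l0 fl; have dotb : dotv a (clip 0 (upper lc) (l *: a)) = b.
  exact/subr0_eq.
split=> [|th [bth boxth]].
  by split=> [|i]; rewrite ?dotb // clip_coord clip_ge0_le ?upper_ge0.
set c := clip _ _ _ in dotb *.
(* The multiplier is [2 * l], since the unconstrained minimizer of the Lagrangian is then
   [l *: a]. *)
have lagr : dotv c c - 2 * l * dotv a c <= dotv th th - 2 * l * dotv a th.
  rewrite !dotvE !mulr_sumr -!sumrB ler_sum // => i _.
  rewrite -!expr2 !mulrA -[2 * l * a i 0]mulrA clip_coord.
  exact: clip_lagrangian_min.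
have := ler_wpM2l l0 bth; rewrite dotb in lagr; lra.
Qed.

Hypothesis hfeas : exists th, feasible a lc b th.

(** If every index were saturated or had [a i 0 <= 0], the clipped vector would maximize [dotv a]
    over the box, so a feasible point would force [0 <= f l]. *)
Lemma unsaturated_neq0 l : 0 <= l -> f l < 0 -> unsaturated l != set0.
Proof.
move=> l0; apply: contraTneq => /setP sat; rewrite -leNgt knap_fE subr_ge0.
case: hfeas => th [bth boxth]; apply: le_trans bth _.
rewrite dotvE ler_sum // => i _; apply: mul_le_clip_saturated => //.
by have := sat i; rewrite !inE => ->.
Qed.

(** The equation says that the tangent line at [l] vanishes at the next iterate; it serves both the
    bound from concavity and the exact root in the linear case. *)
Lemma newton_step l : 0 <= l -> f l < 0 ->
  l < l - f l / df l /\ f l + df l * (l - f l / df l - l) = 0.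
Proof.
move=> l0 fl; have df0 := knap_df_gt0 (unsaturated_neq0 l0 fl).
split; first by rewrite ltrDl oppr_gt0 pmulr_llt0 ?invr_gt0.
by field; rewrite gt_eqF.
Qed.

Hypothesis hb : 0 < b.

Lemma newton_iter_invariant k : 0 <= lam k /\ f (lam k) <= 0.
Proof.
elim: k => [|k [l0 fl]] /=.
  (* At [0] every clipped coordinate is zero, so [f 0 = - b]. *)
  split=> //; rewrite knap_fE big1 ?sub0r ?oppr_le0 ?ltW // => i _.
  by rewrite mul0r maxxx min_l ?mulr0 ?upper_ge0.
case: eqP => [|/eqP fn0] //; have flt : f (lam k) < 0 by rewrite lt_neqAle fn0.
have [lm eq0] := newton_step l0 flt; have m0 := le_trans l0 (ltW lm).
by split=> //; rewrite -eq0 knap_f_supergradient.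
Qed.

Lemma newton_iter_lt0 k : f (lam k) != 0 -> f (lam k) < 0.
Proof. by move=> fn0; rewrite lt_neqAle fn0; case: (newton_iter_invariant k). Qed.

Lemma card_unsaturated_newton k : f (lam k) != 0 ->
  (#|unsaturated (lam k)| + k <= L)%N.
Proof.
elim: k => [|k IH] fn0; first by rewrite addn0 -[leqRHS]card_ord max_card.
have [m0 _] := newton_iter_invariant k.+1.
have [l0 _] := newton_iter_invariant k.
(* The iteration freezes at a root, so an earlier root would persist. *)
have fk : f (lam k) != 0 by apply: contra fn0 => /= fk; rewrite fk.
apply: leq_trans (IH fk); rewrite addnS -addSn leq_add2r proper_card //.
have [lm eq0] := newton_step l0 (newton_iter_lt0 fk).
have stepE : lam k.+1 = lam k - f (lam k) / df (lam k) by rewrite /= ifN.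
rewrite properEneq unsaturatedS ?stepE ?ltW // andbT -stepE.
apply: contra fn0 => /eqP same.
by rewrite (knap_f_linear l0 m0 (esym same)) stepE eq0.
Qed.

Lemma newton_iter_root : f (lam L) = 0.
Proof.
apply/eqP/negPn/negP => fn0; have [l0 _] := newton_iter_invariant L.
(* With [k = L] the count leaves no unsaturated index. *)
have := card_unsaturated_newton fn0; rewrite -[leqRHS]add0n leq_add2r leqn0.
by rewrite cards_eq0 (negPf (unsaturated_neq0 l0 (newton_iter_lt0 fn0))).
Qed.

End Newton.

Theorem theorem3p3 (R : realType) (L : nat) (a lc : 'cV[R]_L) (b : R)
    (hL : (1 <= L)%N)
    (hlc : forall i, 0 <= lc i 0 <= 1)
    (hfeas : exists th, feasible a lc b th)
    (hb : 0 < b) :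
  (forall k, 0 <= newton_iter a lc b k /\
     (knap_f a lc b (newton_iter a lc b k) <> 0 ->
      knap_df a lc (newton_iter a lc b k) <> 0)) /\
  exists (k : nat) (lam : R),
    [/\ (k <= L.+1)%N,
        newton_iter a lc b k = lam,
        knap_f a lc b lam = 0
      & solves_knapsack a lc b (clip 0 (upper lc) (lam *: a))].
Proof.
have inv := newton_iter_invariant hlc hfeas hb.
split=> [k|].
  have [l0 _] := inv k; split=> // /eqP fn0; apply/eqP; rewrite gt_eqF //.
  apply/knap_df_gt0/(unsaturated_neq0 hfeas l0).
  exact: newton_iter_lt0 hlc hfeas hb _ fn0.
have root := newton_iter_root hlc hfeas hb.
(* The index [L] is one below the allowed [L.+1]. *)
exists L, (newton_iter a lc b L); split=> //.
by have [l0 _] := inv L; apply: knap_root_solves.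
Qed.
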